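(* Let $a,b,n$ be non-negative integers, and for $i\in\{1,2,\dots,a+b\}$ let $$A_i=(-1)^{a+b-i}\cdot\frac{i^{a+b}}{(a+b)!}\binom{a+b}{i}.$$ Then $$\beta_n(a+b,b)=(-1)^{\binom{a}{2}}\sum_{1\le i_1<\cdots<i_a\le a+b}\ \left(\prod_{\ell=1}^{a}A_{i_\ell}\right)\left(\prod_{1\le u<v\le a}(i_u-i_v)^2\right)\left(\prod_{\ell=1}^{a}i_\ell^{\,n-a+1}\right)=\gamma_a(n+b,b).$$
   Context: For non-negative integers $m,k$, $\left[{m\atop k}\right]$ denotes the unsigned Stirling number of the first kind (the number of permutations of $m$ elements with exactly $k$ disjoint cycles), and $\left\{{m\atop k}\right\}$ denotes the Stirling number of the second kind (the number of partitions of a set of $m$ objects into $k$ non-empty subsets); both vanish for $k>m$. For non-negative integers $r,s,n$ define $$\beta_n(r,s)=\det\left(\left[{i+r\atop j+s}\right]\right)_{1\le i,j\le n},\qquad \gamma_n(r,s)=\det\left(\left\{{i+r\atop j+s}\right\}\right)_{1\le i,j\le n},$$ with the convention that an empty determinant is $1$ (and empty products are $1$). The exponent $n-a+1$ may be negative, in which case the powers are rational numbers. *)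

(* Defs.v *)
From HB Require Import structures.
From mathcomp Require Import all_boot all_order all_fingroup all_algebra.
Set Implicit Arguments.
Unset Strict Implicit.
Unset Printing Implicit Defensive.

Import Order.TTheory GRing.Theory Num.Theory.
Local Open Scope ring_scope.

(* The cycles of s, fixed points included, are its orbits. *)
Definition stirling1 (m k : nat) : nat :=
  #|[set s : 'S_m | #|porbits s| == k]|.

Definition stirling2 (m k : nat) : nat :=
  #|[set P : {set {set 'I_m}} | partition P [set: 'I_m] & #|P| == k]|.

(* Ordinals start at 0, whence the successors: the row and column indices
   i.+1 and j.+1 run over 1, ..., n. *)
Definition beta (n r s : nat) : int :=
  \det (\matrix_(i < n, j < n) (stirling1 (i.+1 + r) (j.+1 + s))%:Z).

Definition gamma (n r s : nat) : int :=
  \det (\matrix_(i < n, j < n) (stirling2 (i.+1 + r) (j.+1 + s))%:Z).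

(* Meant for 1 <= i <= a + b; the subtraction is truncated beyond that. *)
Definition coefA (a b i : nat) : rat :=
  (-1) ^+ (a + b - i) * (i%:R ^+ (a + b) / ((a + b)`!)%:R) * 'C(a + b, i)%:R.

(* i represents a tuple 1 <= i_1 < ... < i_a <= m. *)
Definition increasing_indices (a m : nat) (i : {ffun 'I_a -> 'I_m.+1}) : bool :=
  [forall l, (0 < i l)%N] &&
  [forall u : 'I_a, forall v : 'I_a, (u < v)%N ==> (i u < i v)%N].

(* Main.v *)
(* The matrices of unsigned first kind and signed second kind Stirling numbers
   are inverse to each other, so beta and gamma are complementary minors of
   mutually inverse triangular matrices, and Jacobi's identity makes them equal.
   For the middle expression put K = a + b.  The recurrence
   S(m, k) = S(m + 1, k + 1) - (k + 1) S(m, k + 1) writes S(m, K - d) as a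
   combination of the S(m + e, K) with e <= d, so column operations turn gamma
   into a Hankel determinant in S(i + j + const, K).  By the explicit formula,
   these entries are the moments of the measure with mass A_x x^(n-a+1) at x,
   and Cauchy-Binet gives a sum of squared Vandermonde determinants. *)
Require Import Defs.
From HB Require Import structures.
From mathcomp Require Import all_boot all_order all_fingroup all_algebra.
From mathcomp Require Import zify ring.
Set Implicit Arguments.
Unset Strict Implicit.
Unset Printing Implicit Defensive.
Import Order.TTheory GRing.Theory Num.Theory.
Local Open Scope ring_scope.

(** * Determinants with entries indexed by natural numbers *)

Section NatIndexedDeterminants.
Variable R : comPzRingType.

(** Taking entries from a function on natural numbers makes the minor a matrix of the same kind, so
    that the expansion can be iterated by induction. *)
Lemma det_expand_unit_col n (f : nat -> nat -> R) (j0 : nat) :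
  (j0 <= n)%N -> (forall i, f i j0 = (i == 0)%:R) ->
  \det (\matrix_(i < n.+1, j < n.+1) f i j) =
  (-1) ^+ j0 * \det (\matrix_(i < n, j < n) f i.+1 (bump j0 j)).
Proof.
move=> le_j0n f_j0.
rewrite (expand_det_col _ (Ordinal (le_j0n : (j0 < n.+1)%N))) big_ord_recl.
rewrite big1 => [|i _]; last by rewrite mxE f_j0 mul0r.
rewrite mxE f_j0 mul1r addr0 /cofactor add0n; congr (_ * \det _).
by apply/matrixP => i j; rewrite !mxE.
Qed.

(** Each of the n unit columns is removed by an expansion along column a, at the cost of a sign
    (-1)^a; the top row goes with it. *)
Lemma det_shifted_unit_cols n a (D : nat -> nat -> R) :
  \det (\matrix_(i < n + a, j < n + a)
          (if (j < a)%N then D i j else ((i : nat) == j - a)%N%:R)) =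
  (-1) ^+ (n * a) * \det (\matrix_(i < a, j < a) D (n + i)%N j).
Proof.
elim: n D => [|n IHn] D.
  rewrite mul0n mul1r; congr (\det _).
  by apply/matrixP => i j; rewrite !mxE ltn_ord.
rewrite addSn (@det_expand_unit_col (n + a)
  (fun i j => if (j < a)%N then D i j else (i == j - a)%N%:R) a);
  first last.
- by move=> i; rewrite ltnn subnn.
- exact: leq_addl.
have := IHn (fun i j => D i.+1 j).
rewrite mulSn exprD -mulrA => <-; congr (_ * \det _).
apply/matrixP => i j; rewrite !mxE /bump.
case: (ltnP j a) => [lt_ja | le_aj]; first by rewrite add0n lt_ja.
by rewrite ltnNge (leq_trans le_aj) ?leq_addl //= add1n subSn.
Qed.

Lemma det_leading_unit_cols n a (C : nat -> nat -> R) :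
  \det (\matrix_(i < n + a, j < n + a)
          (if (j < a)%N then ((i : nat) == j)%:R else C i (j - a)%N)) =
  \det (\matrix_(i < n, j < n) C (a + i)%N j).
Proof.
elim: a C => [|a IHa] C.
  by rewrite addn0; congr (\det _); apply/matrixP => i j; rewrite !mxE subn0.
rewrite addnS (@det_expand_unit_col (n + a)
  (fun i j => if (j < a.+1)%N then (i == j)%:R else C i (j - a.+1)%N) 0) //.
rewrite mul1r; have := IHa (fun i j => C i.+1 j).
by move=> <-; congr (\det _); apply/matrixP => i j; rewrite !mxE /bump leq0n.
Qed.

(* In block form, with D1, D2 the first a columns of D split into n + a rows and
   C1, C2 the first n columns of C split into a + n rows,
   C * [[D1, 1], [D2, 0]] = [[1, C1], [0, C2]]; take determinants. *)
Lemma complementary_minors n a (C D : nat -> nat -> R) :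
    (forall i, C i i = 1) -> (forall i j, (i < j)%N -> C i j = 0) ->
    (forall i j, (i < n + a)%N ->
       \sum_(k < n + a) C i k * D k j = (i == j)%:R) ->
  \det (\matrix_(i < n, j < n) C (a + i)%N j) =
  (-1) ^+ (n * a) * \det (\matrix_(i < a, j < a) D (n + i)%N j).
Proof.
move=> C_diag C_upper CD1.
rewrite -det_leading_unit_cols -det_shifted_unit_cols.
(* C is unitriangular, so multiplying by it preserves the determinant. *)
have detC : \det (\matrix_(i < n + a, j < n + a) C i j) = 1.
  rewrite det_trig; last by apply/is_trig_mxP => i j lt_ij; rewrite mxE C_upper.
  by rewrite big1 // => i _; rewrite mxE.
rewrite -[RHS]mul1r -[X in _ = X * _]detC -det_mulmx; congr (\det _).
apply/matrixP => i j; rewrite !mxE.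
under [RHS]eq_bigr do rewrite !mxE.
case: (ltnP j a) => [_ | le_aj]; first by rewrite CD1.
have lt_j : (j - a < n + a)%N by rewrite (leq_ltn_trans (leq_subr _ _)).
rewrite (bigD1 (Ordinal lt_j)) //= eqxx mulr1 big1 ?addr0 // => k ne_kj.
by rewrite (negPf (_ : (k != j - a :> nat)%N)) ?mulr0.
Qed.

(** The last column holds the values [c 0 e] and is the first unit vector. Expanding along it gives
    (-1)^a and leaves the same matrix for the array c with both indices shifted; the signs add up by
    Pascal's rule. *)
Lemma det_antitriangular a (c : nat -> nat -> R) :
    (forall d, c d d = 1) -> (forall d e, (d < e)%N -> c d e = 0) ->
  \det (\matrix_(e < a, j < a) c (a.-1 - j)%N e) = (-1) ^+ 'C(a, 2).
Proof.
elim: a c => [|a IHa] c c_diag c_upper; first by rewrite det_mx00 bin0n.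
rewrite (@det_expand_unit_col a (fun e j => c (a.+1.-1 - j)%N e) a) //;
  last by move=> [|i] /=; rewrite subnn ?c_diag ?c_upper.
rewrite binS bin1 addnC exprD.
rewrite -(IHa _ (fun d => c_diag d.+1) (fun d e => c_upper d.+1 e.+1)).
congr (_ * _); congr (\det _); apply/matrixP => e j; rewrite !mxE /=.
rewrite /bump leqNgt ltn_ord add0n.
by congr (c _ _); have := ltn_ord j; lia.
Qed.

(** The signs factor into diagonal matrices on the left and right; at each index i, (-1)^(m + i) and
    (-1)^i combine to (-1)^m. *)
Lemma det_alternate_signs m n (f : nat -> nat -> R) :
  \det (\matrix_(i < n, j < n) ((-1) ^+ (m + i + j) * f i j)) =
  (-1) ^+ (m * n) * \det (\matrix_(i < n, j < n) f i j).
Proof.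
have -> : \matrix_(i < n, j < n) ((-1) ^+ (m + i + j) * f i j) =
    diag_mx (\row_i (-1) ^+ (m + i)) *m \matrix_(i < n, j < n) f i j
      *m diag_mx (\row_j (-1) ^+ j).
  apply/matrixP => i j; rewrite mul_mx_diag mul_diag_mx !mxE.
  by rewrite [in LHS]exprD; ring.
rewrite !det_mulmx !det_diag mulrAC -big_split /=; congr (_ * _).
rewrite (eq_bigr (fun=> (-1) ^+ m)) => [|i _].
  by rewrite prodr_const card_ord exprM.
rewrite !mxE -exprD -addnA addnn exprD.
by rewrite -[X in _ * X]signr_odd odd_double mulr1.
Qed.

End NatIndexedDeterminants.

(** * Recurrence for the Stirling numbers of the first kind *)

Section FirstKind.
Local Open Scope nat_scope.

Lemma porbit_lift_perm m (x : 'I_m.+1) (t : 'S_m) (y : 'I_m) :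
  porbit (lift_perm x x t) (lift x y) = lift x @: porbit t y.
Proof.
have liftX i : (lift_perm x x t ^+ i)%g (lift x y) = lift x ((t ^+ i)%g y).
  elim: i => [|i IHi]; first by rewrite !expg0 !perm1.
  by rewrite !expgSr !permM IHi lift_perm_lift.
apply/setP => z; apply/porbitP/imsetP => [[i ->] | [_ /porbitP[i ->] ->]].
  by exists ((t ^+ i)%g y); rewrite ?liftX ?mem_porbit.
by exists i; rewrite liftX.
Qed.

Lemma porbit_fixed (T : finType) (s : {perm T}) x :
  s x = x -> porbit s x = [set x].
Proof.
move=> sx; apply/setP => y; rewrite inE; apply/porbitP/eqP => [[i ->] | ->].
  by elim: i => [|i IHi]; rewrite ?expg0 ?perm1 // expgSr permM IHi.
by exists 0; rewrite expg0 perm1.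
Qed.

Lemma card_porbits_lift_perm m (x : 'I_m.+1) (t : 'S_m) :
  #|porbits (lift_perm x x t)| = #|porbits t|.+1.
Proof.
have -> : porbits (lift_perm x x t) =
    [set x] |: [set lift x @: (O : {set 'I_m}) | O in porbits t].
  apply/setP => O; rewrite !inE; apply/imsetP/orP => [[z _ ->] | ].
    have [y ->|->] := unliftP x z.
      by right; rewrite porbit_lift_perm !imset_f.
    by left; rewrite porbit_fixed // lift_perm_id.
  case=> [/eqP-> | /imsetP[_ /imsetP[y _ ->] ->]].
    by exists x; rewrite ?porbit_fixed ?lift_perm_id.
  by exists (lift x y); rewrite ?porbit_lift_perm.
rewrite cardsU1 card_imset; last exact/imset_inj/lift_inj.
case: imsetP => // -[O _ eqO].
have : x \in lift x @: O by rewrite -eqO set11.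
by case/imsetP => y _ /eqP; rewrite (negPf (neq_lift _ _)).
Qed.

(** For x other than [ord_max], the transposition merges the fixed point [ord_max] into the cycle of
    x; otherwise it is trivial and the fixed point is an additional cycle. *)
Lemma card_porbits_tperm_lift_perm m (x : 'I_m.+1) (t : 'S_m) :
  #|porbits (tperm x ord_max * lift_perm ord_max ord_max t)%g| =
  #|porbits t| + (x == ord_max).
Proof.
have := porbits_mul_tperm (lift_perm ord_max ord_max t) x ord_max.
rewrite /= porbit_fixed ?lift_perm_id // inE card_porbits_lift_perm.
by case: eqP => _ /=; lia.
Qed.

Lemma tperm_lift_perm_bij m :
  bijective (fun p : 'I_m.+1 * 'S_m =>
    tperm p.1 ord_max * lift_perm ord_max ord_max p.2)%g.
Proof.
apply: inj_card_bij => [[x t] [y u] /= eq_xy|].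
  (* x is recovered as the preimage of [ord_max]; cancelling the transposition then determines t. *)
  have exy : x = y.
    have inv z (v : 'S_m) :
        (tperm z ord_max * lift_perm ord_max ord_max v)%g z = ord_max.
      by rewrite permM tpermL lift_perm_id.
    by apply: (@perm_inj _ (tperm x ord_max * lift_perm ord_max ord_max t)%g);
      rewrite inv eq_xy inv.
  rewrite exy in eq_xy *; have /mulgI/permP eq_tu := eq_xy.
  congr (_, _); apply/permP => z; apply: (@lift_inj _ ord_max).
  by rewrite -!(lift_perm_lift ord_max) eq_tu.
by rewrite card_prod !card_Sn card_ord factS.
Qed.

Lemma stirling1_0 k : stirling1 0 k = (k == 0).
Proof.
rewrite /stirling1; have porb0 (s : 'S_0) : #|porbits s| = 0.
  by apply/eqP; rewrite -leqn0 (leq_trans (leq_imset_card _ _)) ?card_ord.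
under eq_finset => s do rewrite porb0 eq_sym.
by case: k => [|k] /=; rewrite ?cards0 // cardsE card_Sn.
Qed.

Lemma stirling1_sum m k : stirling1 m k = \sum_(s : 'S_m) (#|porbits s| == k).
Proof.
rewrite /stirling1 -sum1_card big_mkcond; apply: eq_bigr => s _.
by rewrite inE; case: eqP.
Qed.

(** The choice x = [ord_max] gives the first sum, and each of the m other choices gives one copy of
    [stirling1 m k]. The first sum is left unevaluated so that k = 0 is covered too. *)
Lemma stirling1_rec m k :
  stirling1 m.+1 k = \sum_(t : 'S_m) (#|porbits t|.+1 == k) + m * stirling1 m k.
Proof.
rewrite !stirling1_sum (reindex _ (onW_bij _ (tperm_lift_perm_bij m))) /=.
under eq_bigr do rewrite card_porbits_tperm_lift_perm.
rewrite -(pair_bigA _ (fun x (t : 'S_m) =>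
  (#|porbits t| + (x == ord_max) == k : nat))) /=.
rewrite big_ord_recr /=; under [X in _ + X]eq_bigr do rewrite eqxx addn1.
rewrite addnC; congr (_ + _).
rewrite (eq_bigr (fun=> \sum_(t : 'S_m) (#|porbits t| == k))).
  by rewrite sum_nat_const card_ord.
move=> i _; apply: eq_bigr => t _.
by rewrite -val_eqE /= (ltn_eqF (ltn_ord i)) addn0.
Qed.

Lemma stirling1S0 m : stirling1 m.+1 0 = m * stirling1 m 0.
Proof. by rewrite stirling1_rec big1. Qed.

Lemma stirling1SS m k :
  stirling1 m.+1 k.+1 = stirling1 m k + m * stirling1 m k.+1.
Proof. by rewrite stirling1_rec [X in _ = X + _]stirling1_sum. Qed.

End FirstKind.

(** * Adding one element to a set partition *)

Section SetPartitions.
Local Open Scope nat_scope.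
Variable T : finType.
Implicit Types (P : {set {set T}}) (E : {set T}).

Lemma setD1_notin (U : finType) (a : U) (A : {set U}) :
  a \notin A -> A :\ a = A.
Proof. by move=> aA; apply/setDidPl; rewrite disjoint_sym disjoints1. Qed.

(** The ground set is an arbitrary subset E, so that induction can remove one element at a time;
    [stirling2] is the case of the full set of ordinals. *)
Definition set_partitions E k := [set P | partition P E & #|P| == k].

Lemma set_partitions0 k : #|set_partitions set0 k| = (k == 0).
Proof.
rewrite /set_partitions; under eq_finset => P do rewrite partition_set0.
case: k => [|k].
  rewrite eqxx /= -(cards1 (set0 : {set {set T}})); congr #|pred_of_set _|.
  by apply/setP => P; rewrite !inE; case: eqP => // ->; rewrite cards0.
apply/eqP; rewrite cards_eq0 -subset0; apply/subsetP => P.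
by rewrite inE => /andP[/eqP->]; rewrite cards0.
Qed.

Lemma set_partitionsU1_0 x E : #|set_partitions (x |: E) 0| = 0.
Proof.
apply/eqP; rewrite cards_eq0 -subset0; apply/subsetP => P.
rewrite inE cards_eq0 => /andP[partP /eqP P0].
have := cover_partition partP; rewrite P0 /cover big_set0 => /setP/(_ x).
by rewrite !inE eqxx.
Qed.

(* For x \notin E, this is a bijection onto the partitions of x |: E from the
   pairs (P, B) with P a partition of E and B either a block of P, which x
   joins, or the empty set, in which case {x} is a new block. *)
Definition adjoin x (p : {set {set T}} * {set T}) :=
  (x |: p.2) |: (p.1 :\ p.2).

Lemma adjoin_partition x E P B : x \notin E ->
  partition P E -> (B == set0) || (B \in P) ->
  partition (adjoin x (P, B)) (x |: E) /\
  #|adjoin x (P, B)| = #|P| + (B == set0).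
Proof.
move=> xE partP B0P; rewrite /adjoin /=.
have BE : B \subset E.
  by case/orP: B0P => [/eqP->|/(partitionS partP)]; rewrite ?sub0set.
have partPB : partition (P :\ B) (E :\: B).
  case/predU1P: B0P => [->|]; last exact: partitionD1.
  by rewrite setD0 setD1_notin // (partition0 partP).
have xB0 : x |: B != set0 by apply/set0Pn; exists x; rewrite setU11.
have dis : [disjoint x |: B & E :\: B].
  rewrite -setI_eq0; apply/eqP/setP => y; rewrite !inE.
  by case: eqP => [->|_] /=; rewrite ?(negPf xE) ?andbF //; case: (y \in B).
have xBP : x |: B \notin P :\ B.
  apply: contra xE => /setD1P[_ /(partitionS partP)/subsetP/(_ x)].
  by apply; rewrite setU11.
split.
  have := partitionU1 partPB xB0 dis.
  have -> : (x |: B) :|: E :\: B = x |: E.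
    by rewrite -setUA -{1}(setIidPr BE) setID.
  exact.
rewrite cardsU1 xBP; case/predU1P: B0P => [->|BP].
  by rewrite setD1_notin ?(partition0 partP) // eqxx addnC.
by rewrite (negPf (partition_neq0 partP BP)) addn0 [in RHS](cardsD1 B) BP.
Qed.

(** The block of x in the result is [x |: B], which determines B. Removing that block, and putting B
    back if it is nonempty, then recovers P. *)
Lemma adjoin_inj x E : x \notin E ->
  {in [pred p | partition p.1 E & (p.2 == set0) || (p.2 \in p.1)] &,
    injective (adjoin x)}.
Proof.
move=> xE [P B] [Q C]; rewrite !inE /= => /andP[pP bP] /andP[pQ bQ] eqPQ.
have sub p : partition p.1 E -> (p.2 == set0) || (p.2 \in p.1) ->
  pblock (adjoin x p) x = x |: p.2.
  case: p => P' B' /= p1 p2; have [pA _] := adjoin_partition xE p1 p2.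
  by apply: (def_pblock (partition_trivIset pA)); apply: setU11.
have xnot p : partition p.1 E -> (p.2 == set0) || (p.2 \in p.1) -> x \notin p.2.
  case: p => P' B' /= p1 /predU1P[->|]; first by rewrite inE.
  by move=> /(partitionS p1)/subsetP/(_ x) H; apply: contra xE.
have eqBC : B = C.
  have := sub (P, B) pP bP; rewrite eqPQ (sub (Q, C)) //= => /setP eqBC.
  apply/setP => y; have := eqBC y; rewrite !inE; case: (y =P x) => //= -> _.
  by rewrite (negPf (xnot (P, B) pP bP)) (negPf (xnot (Q, C) pQ bQ)).
congr (_, _) => //; move: eqPQ; rewrite -{}eqBC in pQ bQ *.
have rem P' : partition P' E -> (B == set0) || (B \in P') ->
  P' = (if B == set0 then id else setU [set B]) (adjoin x (P', B) :\ (x |: B)).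
  move=> p1 p2; rewrite /adjoin /= setU1K; last first.
    apply: contra xE => /setD1P[_ /(partitionS p1)/subsetP/(_ x)].
    by apply; rewrite setU11.
  case: eqP p2 => [-> _ | _ /= BP']; last by rewrite setD1K.
  by rewrite setD1_notin // (partition0 p1).
by move=> eqPQ; rewrite (rem P) // eqPQ -rem.
Qed.

Lemma adjoin_surj x E P : x \notin E -> partition P (x |: E) ->
  exists2 p, partition p.1 E && ((p.2 == set0) || (p.2 \in p.1))
           & P = adjoin x p.
Proof.
move=> xE partP.
have xP : x \in cover P by rewrite (cover_partition partP) setU11.
set B := pblock P x.
have xB : x \in B by rewrite mem_pblock.
have BP : B \in P by rewrite pblock_mem.
have BE := partitionS partP BP.
have pD := partitionD1 partP BP.
have ED : (x |: E) :\: B = E :\: (B :\ x).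
  apply/setP => y; rewrite !inE; case: (y =P x) => [->|]; last by [].
  by rewrite xB (negPf xE) andbF.
rewrite ED in pD.
have BxE : B :\ x \subset E.
  by apply/subsetP => y /setD1P[/negPf yx /(subsetP BE)]; rewrite !inE yx.
(* A nonempty block inside the complement of [B :\ x] cannot equal [B :\ x]. *)
have BxP : B :\ x \notin P :\ B.
  apply/negP => Bx; have nB := partition_neq0 pD Bx.
  case/set0Pn: nB => y yB.
  by have /subsetP/(_ y yB) := partitionS pD Bx; rewrite in_setD yB.
have [Bx0|Bx0] := eqVneq (B :\ x) set0.
  exists (P :\ B, set0); rewrite /adjoin /=.
    by move: pD; rewrite Bx0 setD0 eqxx => ->.
  rewrite -{1}Bx0 setD1K // setD1_notin ?(partition0 pD) //.
  by rewrite setD1K.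
exists ((B :\ x) |: (P :\ B), B :\ x); rewrite /adjoin /=.
  rewrite setU11 orbT andbT.
  have := partitionU1 pD Bx0.
  have -> : (B :\ x) :|: E :\: (B :\ x) = E by rewrite -{1}(setIidPr BxE) setID.
  apply.
  by rewrite -setI_eq0 setIDA setIC -setIDA setDv setI0.
by rewrite setD1K // setU1K // setD1K.
Qed.

Lemma card_set_partitionsU1 x E k : x \notin E ->
  #|set_partitions (x |: E) k.+1| =
  #|set_partitions E k| + k.+1 * #|set_partitions E k.+1|.
Proof.
move=> xE.
pose blocks := [pred p : {set {set T}} * {set T} |
  partition p.1 E & (p.2 == set0) || (p.2 \in p.1)].
have -> : set_partitions (x |: E) k.+1 =
    adjoin x @: [set p in blocks | #|p.1| + (p.2 == set0) == k.+1].
  apply/setP => P; rewrite inE; apply/andP/imsetP => [[partP cardP]|].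
    have [[Q B] /andP[pQ pB] defP] := adjoin_surj xE partP.
    exists (Q, B) => //; rewrite !inE pQ pB /=.
    by have [_ <-] := adjoin_partition xE pQ pB; rewrite -defP.
  case=> [[Q B]]; rewrite !inE -andbA => /and3P[/= pQ pB cardQ] ->.
  by have [-> ->] := adjoin_partition xE pQ pB.
rewrite card_in_imset => [|p q]; last first.
  by rewrite !inE => /andP[p1 _] /andP[q1 _]; apply: (adjoin_inj xE).
rewrite -sum1_card big_mkcond /=.
set pairs := [set _ in _ | _].
transitivity (\sum_P \sum_B if (P, B) \in pairs then 1 else 0).
  by rewrite pair_bigA; apply: eq_bigr => -[].
rewrite -!sum1_card big_distrr /= !(big_mkcond (mem (set_partitions _ _))).
rewrite -big_split; apply: eq_bigr => P _ /=; rewrite !inE /=.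
have [partP|partP] := boolP (partition P E); last first.
  by apply: big1 => B _; rewrite !inE /= (negPf partP).
(* For fixed P, the empty B contributes when P has k blocks, and the nonempty choices contribute
   k.+1 when P has k.+1 blocks. *)
rewrite (bigD1 set0) //= !inE /= partP eqxx /= addn1 eqSS; congr (_ + _).
rewrite (eq_bigr (fun B => if B \in P then (#|P| == k.+1 : nat) else 0));
  last first.
  move=> B /negPf B0; rewrite !inE /= partP B0 /= addn0.
  by case: (B \in P); case: eqP.
rewrite -big_mkcondr /= (eq_bigl (mem P)); last first.
  by move=> B; apply: andb_idl => /(partition_neq0 partP).
by rewrite sum_nat_const; case: eqP => [->|_]; rewrite ?muln1 ?muln0.
Qed.

End SetPartitions.

(** * Recurrence for the Stirling numbers of the second kind *)

Section SecondKind.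
Local Open Scope nat_scope.

(** Both counts obey the recurrence of [card_set_partitionsU1], so induction on the common
    cardinality takes the place of transport along a bijection. *)
Lemma card_set_partitions_eq (T U : finType) (E : {set T}) (F : {set U}) k :
  #|E| = #|F| -> #|set_partitions E k| = #|set_partitions F k|.
Proof.
move eqn : #|E| => n; elim: n E F k eqn => [|n IHn] E F k cardE cardF.
  by rewrite (cards0_eq cardE) (cards0_eq (esym cardF)) !set_partitions0.
have [x xE] : exists x, x \in E by apply/set0Pn; rewrite -card_gt0 cardE.
have [y yF] : exists y, y \in F by apply/set0Pn; rewrite -card_gt0 -cardF.
have cE : #|E :\ x| = n by move: cardE; rewrite (cardsD1 x) xE => -[].
have cF : n = #|F :\ y| by move: cardF; rewrite (cardsD1 y) yF => -[].
rewrite -(setD1K xE) -(setD1K yF).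
case: k => [|k]; first by rewrite !set_partitionsU1_0.
by rewrite !card_set_partitionsU1 ?setD11 // !(IHn _ _ _ cE cF).
Qed.

Lemma stirling2_0 k : stirling2 0 k = (k == 0).
Proof.
rewrite -(set_partitions0 (ordinal 0)) /stirling2.
apply: (@card_set_partitions_eq _ _ [set: 'I_0]).
by rewrite cards0 cardsT card_ord.
Qed.

Lemma stirling2S0 m : stirling2 m.+1 0 = 0.
Proof.
rewrite -[RHS](set_partitionsU1_0 (ord0 : 'I_m.+1) setT).
by rewrite setUT.
Qed.

Lemma stirling2SS m k :
  stirling2 m.+1 k.+1 = stirling2 m k + k.+1 * stirling2 m k.+1.
Proof.
pose E := [set~ (ord0 : 'I_m.+1)].
have cE : #|E| = #|[set: 'I_m]| by rewrite cardsC1 cardsT !card_ord.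
have -> : stirling2 m.+1 k.+1 = #|set_partitions (ord0 |: E) k.+1|.
  by rewrite setUCr.
rewrite card_set_partitionsU1 ?inE ?eqxx // !(card_set_partitions_eq _ cE).
by [].
Qed.

End SecondKind.

(** * Orthogonality of the two kinds and equality of the two minors *)

Lemma stirling1_small m k : (m < k)%N -> stirling1 m k = 0%N.
Proof.
elim: m k => [|m IHm] [|k] // lt_mk; first by rewrite stirling1_0.
by rewrite stirling1SS !IHm ?muln0 // ltnW.
Qed.

Lemma stirling1_diag m : stirling1 m m = 1%N.
Proof.
elim: m => [|m IHm]; first by rewrite stirling1_0.
by rewrite stirling1SS IHm stirling1_small ?muln0.
Qed.

Lemma stirling2_small m k : (m < k)%N -> stirling2 m k = 0%N.
Proof.
elim: m k => [|m IHm] [|k] // lt_mk; first by rewrite stirling2_0.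
by rewrite stirling2SS !IHm ?muln0 // ltnW.
Qed.

Lemma stirling_orthogonality N i j : (i < N)%N ->
  \sum_(k < N) (-1) ^+ (k + j) * (stirling1 i k)%:Z * (stirling2 k j)%:Z =
  (i == j)%:R.
Proof.
elim: i N j => [|i IHi] [|N] // j lt_iN.
  rewrite big_ord_recl big1 => [|k _]; last by rewrite stirling1_0 mulr0 mul0r.
  rewrite stirling1_0 stirling2_0 addr0 eq_sym mulr1.
  by case: j => [|j]; rewrite ?mulr0.
pose F (l : nat) (k : nat) :=
  (-1) ^+ (k + l) * (stirling1 i k)%:Z * (stirling2 k l)%:Z.
have FD l : \sum_(k < N) F l k = (i == l)%:R by apply: IHi.
have F1 l : \sum_(k < N.+1) F l k = (i == l)%:R by apply: IHi; apply: ltnW.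
(* The recurrence of the first kind splits off i times the induction hypothesis; the rest is
   reindexed by k.+1 and has one term fewer, hence the two ranges N and N.+1. *)
have shift : \sum_(k < N.+1)
      (-1) ^+ (k + j) * (stirling1 i.+1 k)%:Z * (stirling2 k j)%:Z =
  i%:Z * (i == j)%:R +
  \sum_(k < N) (-1) ^+ (k.+1 + j) * (stirling1 i k)%:Z * (stirling2 k.+1 j)%:Z.
  rewrite -F1 big_distrr !big_ord_recl /= -addrA -big_split /=; congr (_ + _).
    by rewrite stirling1S0 /F /=; lia.
  apply: eq_bigr => k _.
  by rewrite /F /bump leq0n add1n stirling1SS PoszD PoszM; ring.
rewrite shift; case: j {shift} => [|j].
  rewrite big1 => [|k _]; last by rewrite stirling2S0 mulr0.
  by case: i {IHi lt_iN F FD F1} => [|i]; rewrite ?mulr0.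
(* The recurrence of the second kind leaves the contributions i and -(j + 1) at i = j + 1, which
   cancel. *)
rewrite (eq_bigr (fun k : 'I_N => F j k - j.+1%:Z * F j.+1 k)) => [|k _].
  rewrite sumrB -big_distrr /= !FD eqSS.
  case: (i =P j.+1) => [->|_] /=; rewrite ?mulr1 ?mulr0; last by ring.
  by rewrite addrC subrK.
by rewrite /F stirling2SS PoszD PoszM !(addSn, addnS, exprS); ring.
Qed.

Lemma beta_gamma a b n : beta n (a + b) b = gamma a (n + b) b.
Proof.
pose C i j := (stirling1 (i + b.+1) (j + b.+1))%:Z.
pose D i j := (-1) ^+ (i + j) * (stirling2 (i + b.+1) (j + b.+1))%:Z.
have -> : beta n (a + b) b = \det (\matrix_(i < n, j < n) C (a + i)%N j).
  congr (\det _); apply/matrixP => i j; rewrite !mxE /C.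
  by congr (Posz (stirling1 _ _)); lia.
rewrite (@complementary_minors _ n a C D).
(* Pulling the signs out of D gives a second factor (-1)^(n * a), which cancels the one from the
   complementary minors. *)
- rewrite (@det_alternate_signs _ n a
    (fun i j => (stirling2 (n + i + b.+1) (j + b.+1))%:Z)).
  rewrite mulrA -exprD addnn -signr_odd odd_double mul1r.
  congr (\det _); apply/matrixP => i j; rewrite !mxE.
  by congr (Posz (stirling2 _ _)); lia.
- by move=> i; rewrite /C stirling1_diag.
- by move=> i j lt_ij; rewrite /C stirling1_small // ltn_add2r.
move=> i j lt_i.
(* Cutting off the indices below b + 1 keeps the matrices inverse: the omitted terms contain S(k, j
   + b + 1) with k < b + 1, which is 0. *)
have := @stirling_orthogonality (b.+1 + (n + a)) (i + b.+1) (j + b.+1).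
rewrite eqn_add2r => <-; last by lia.
rewrite [RHS]big_split_ord /= [X in _ = X + _]big1 ?add0r => [|k _]; last first.
  by rewrite stirling2_small ?mulr0 // ltn_addl.
apply: eq_bigr => k _; rewrite /C /D [(b.+1 + k)%N]addnC.
have -> : (-1) ^+ (k + b.+1 + (j + b.+1)) = (-1) ^+ (k + j) :> int.
  by rewrite addnACA exprD addnn -[X in _ * X]signr_odd odd_double mulr1.
ring.
Qed.

(** * Explicit formula and descent in the lower index *)

Lemma stirling2_explicit m k :
  (k`!)%:R * (stirling2 m k)%:R =
  \sum_(x < k.+1) (-1) ^+ (k - x) * 'C(k, x)%:R * x%:R ^+ m :> rat.
Proof.
elim: m k => [|m IHm] k.
  rewrite stirling2_0; transitivity ((-1 + 1) ^+ k : rat).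
    by rewrite addNr expr0n; case: k => [|k]; rewrite ?mulr0.
  rewrite exprDn; apply: eq_bigr => x _.
  by rewrite expr0 expr1n !mulr1 mulr_natr.
case: k => [|k].
  by rewrite stirling2S0 big_ord_recl big_ord0 expr0n !mulr0 addr0.
(* Pascal's rule puts the absorption identity in terms of rows k + 1 and k, the two at which the
   induction hypothesis is applied. *)
have absorb x : x%:R * 'C(k.+1, x)%:R =
    k.+1%:R * ('C(k.+1, x)%:R - 'C(k, x)%:R) :> rat.
  case: x => [|x]; first by rewrite !bin0 subrr mul0r mulr0.
  by rewrite -!natrM -mul_bin_diag binS natrD addrC addKr natrM.
transitivity (k.+1%:R *
    (\sum_(x < k.+2) (-1) ^+ (k.+1 - x) * 'C(k.+1, x)%:R * x%:R ^+ m -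
     \sum_(x < k.+2) (-1) ^+ (k.+1 - x) * 'C(k, x)%:R * x%:R ^+ m) : rat).
  rewrite -IHm big_ord_recr /= bin_small // mulr0 mul0r addr0.
  rewrite (eq_bigr (fun x : 'I_k.+1 =>
    - ((-1) ^+ (k - x) * 'C(k, x)%:R * x%:R ^+ m))) => [|x _].
    by rewrite sumrN -IHm stirling2SS factS !natrD !natrM; ring.
  by rewrite subSn ?exprS -1?ltnS //; ring.
rewrite -sumrB big_distrr; apply: eq_bigr => x _ /=.
have := absorb x; rewrite exprS => absorb_x.
transitivity ((-1) ^+ (k.+1 - x) * (x%:R * 'C(k.+1, x)%:R) * x%:R ^+ m : rat).
  by rewrite absorb_x; ring.
by ring.
Qed.

(** For d at most K, this is the coefficient of X^e in the product of X - (K - t) over t < d, where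
    X stands for the shift from m to m + 1. *)
Fixpoint descent_coef (R : pzRingType) (K d e : nat) : R :=
  match d with
  | 0 => (e == 0)%:R
  | d'.+1 => (if e is e'.+1 then descent_coef R K d' e' else 0) -
             (K - d')%:R * descent_coef R K d' e
  end.

Lemma descent_coef_gt (R : pzRingType) K d e :
  (d < e)%N -> descent_coef R K d e = 0.
Proof.
elim: d e => [|d IHd] [|e] //= lt_de.
by rewrite !IHd ?mulr0 ?subrr // ltnW.
Qed.

Lemma descent_coef_diag (R : pzRingType) K d : descent_coef R K d d = 1.
Proof. by elim: d => //= d ->; rewrite descent_coef_gt // mulr0 subr0. Qed.

Lemma stirling2_descent (R : comPzRingType) K d N m : (d <= K)%N -> (d < N)%N ->
  (stirling2 m (K - d))%:R =
  \sum_(e < N) descent_coef R K d e * (stirling2 (m + e) K)%:R.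
Proof.
elim: d N m => [|d IHd] [|N] m // le_dK lt_dN.
  rewrite big_ord_recl big1 => [|e _]; last by rewrite mul0r.
  by rewrite addr0 mul1r addn0 subn0.
transitivity ((stirling2 m.+1 (K - d))%:R -
    (K - d)%:R * (stirling2 m (K - d))%:R : R).
  have -> : (K - d = (K - d.+1).+1)%N by lia.
  by rewrite stirling2SS natrD natrM addrK.
(* The sum at m.+1 has its coefficients shifted by one, so it runs to N while the sum at m runs to
   N.+1. *)
rewrite (IHd N m.+1) ?(IHd N.+1 m) //; try lia.
rewrite big_distrr /= !big_ord_recl.
rewrite opprD addrCA -sumrB; congr (_ + _); first by rewrite sub0r mulrA mulNr.
apply: eq_bigr => e _; rewrite /= /bump leq0n add1n addSnnS; ring.
Qed.

(** * The Cauchy-Binet formula for moment matrices *)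

Section CauchyBinet.
Variables a m : nat.
Implicit Types (f g : {ffun 'I_a -> 'I_m}) (s : 'S_a).

Definition precomp f s : {ffun 'I_a -> 'I_m} := [ffun i => f (s i)].

Definition increasing f :=
  [forall u : 'I_a, forall v : 'I_a, (u < v)%N ==> (f u < f v)%N].

Lemma increasingP f :
  reflect (forall u v, (f u < f v)%N = (u < v)%N) (increasing f).
Proof.
apply: (iffP forallP) => [inc_f | mono_f u]; last first.
  by apply/forallP => v; rewrite mono_f implybb.
have homo_f (u v : 'I_a) : (u < v)%N -> (f u < f v)%N.
  by apply/implyP/(forallP (inc_f u)).
move=> u v; case: (ltngtP u v) => [/homo_f -> // | /homo_f lt_vu | /val_inj ->].
  by rewrite ltnNge ltnW.
by rewrite ltnn.
Qed.

Lemma increasing_inj f : increasing f -> injective f.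
Proof.
move/increasingP=> mono_f u v eq_f; apply/val_inj.
by have := mono_f u v; have := mono_f v u; rewrite eq_f ltnn; case: ltngtP.
Qed.

(* r u is the number of v with f v < f u. *)
Lemma injective_unsort f : injective f ->
  exists r : 'S_a, forall s, increasing (precomp f s^-1%g) = (s == r).
Proof.
move=> inj_f; pose below u := [set v | (f v < f u)%N].
have lt_below u v : (f u < f v)%N -> (#|below u| < #|below v|)%N.
  move=> lt_uv; apply/proper_card/properP; split.
    by apply/subsetP => w; rewrite !inE => /ltn_trans; apply.
  by exists u; rewrite !inE ?ltnn.
have bound u : (#|below u| < a)%N.
  rewrite -[a in leqRHS]card_ord -cardsT; apply/proper_card/properP.
  by split; [apply: subsetT | exists u; rewrite ?inE ?ltnn].
have mono u v : (#|below u| < #|below v|)%N = (f u < f v)%N.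
  case: (ltngtP (f u) (f v)) => [/lt_below -> // | /lt_below lt_vu |].
    by rewrite ltnNge ltnW.
  by move=> /val_inj/inj_f ->; rewrite ltnn.
have inj_r : injective (fun u => Ordinal (bound u)).
  move=> u v [eq_uv]; apply/inj_f/val_inj.
  by have := mono u v; have := mono v u; rewrite eq_uv ltnn; case: ltngtP.
exists (perm inj_r) => s; apply/increasingP/eqP => [inc_fs | -> u v].
  apply/permP => u; rewrite permE; apply/val_inj => /=.
  (* If reordering by the inverse of s sorts f, then u has rank s u, which forces s to be the
     ranking. *)
  have -> : below u = s @^-1: [set i : 'I_a | (i < s u)%N].
    by apply/setP => v; rewrite !inE -inc_fs !ffunE !permK.
  rewrite card_preimset; last exact: perm_inj.
  rewrite -sum1dep_card -(big_ord_widen a (fun=> 1%N)) ?sum1_card ?card_ord //.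
  exact/ltnW.
rewrite !ffunE -mono.
by rewrite -{2}(permKV (perm inj_r) u) -{2}(permKV (perm inj_r) v) !permE.
Qed.

(** Every injective f factors uniquely as an increasing g precomposed with a permutation. *)
Lemma sum_injective (V : nmodType) (F : {ffun 'I_a -> 'I_m} -> V) :
  \sum_(f : {ffun 'I_a -> 'I_m} | injectiveb f) F f =
  \sum_(g : {ffun 'I_a -> 'I_m} | increasing g) \sum_(s : 'S_a) F (precomp g s).
Proof.
rewrite exchange_big /=.
rewrite (eq_bigr (fun s =>
  \sum_(f : {ffun _} | increasing (precomp f s^-1%g)) F f)) => [|s _].
  rewrite (exchange_big_dep xpredT) //= big_mkcond; apply: eq_bigr => f _.
  case: injectiveP => [/injective_unsort[r r_unique] | not_inj].
    by rewrite (big_pred1 r) // => s; rewrite r_unique.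
  rewrite big1 // => s /increasing_inj inj_fs; case: not_inj => u v eq_uv.
  by apply/(@perm_inj _ s)/inj_fs; rewrite !ffunE !permK.
rewrite [RHS](reindex (precomp^~ s)) /=.
  apply: eq_bigl => g; congr increasing.
  by apply/ffunP => i; rewrite !ffunE permKV.
exists (precomp^~ s^-1%g) => f _.
  by apply/ffunP => i; rewrite !ffunE permKV.
by apply/ffunP => i; rewrite !ffunE permK.
Qed.

Lemma det_moments (R : comPzRingType) (w p : 'I_m -> R) :
  \det (\matrix_(i < a, j < a) \sum_(x < m) w x * p x ^+ (i + j)) =
  \sum_(g : {ffun 'I_a -> 'I_m} | increasing g)
    \prod_(l < a) w (g l) *
    \prod_(u < a) \prod_(v < a | (u < v)%N) (p (g u) - p (g v)) ^+ 2.
Proof.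
pose V f := \det (\matrix_(i < a, j < a) p (f i) ^+ j).
pose G f := \prod_(l < a) w (f l) * \prod_(l < a) p (f l) ^+ l * V f.
(* Expanding the product over the rows chooses a point f i for row i; the sum over permutations then
   collects into V f. *)
transitivity (\sum_f G f).
  rewrite /determinant; under eq_bigr => s _.
    under eq_bigr do rewrite mxE.
    rewrite bigA_distr_bigA /= big_distrr /=; over.
  rewrite exchange_big /=; apply: eq_bigr => f _.
  rewrite /G /V /determinant big_distrr; apply: eq_bigr => s _ /=.
  rewrite mulrCA; congr (_ * _); rewrite -!big_split /=.
  by apply: eq_bigr => i _; rewrite mxE exprD mulrA.
rewrite (bigID (fun f : {ffun 'I_a -> 'I_m} => injectiveb f)) /=.
rewrite [X in _ + X]big1 ?addr0.
  rewrite sum_injective; apply: eq_bigr => g _.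
  have sgnV s : V (precomp g s) = (-1) ^+ s * V g.
    rewrite -det_perm -det_mulmx -row_permE; congr (\det _).
    by apply/matrixP => i j; rewrite !mxE ffunE.
  rewrite (eq_bigr (fun s => \prod_(l < a) w (g l) * V g *
      ((-1) ^+ s * \prod_(l < a) p (g (s l)) ^+ l))) => [|s _]; last first.
    rewrite /G sgnV (reindex_inj (@perm_inj _ s^-1%g)) /=.
    under eq_bigr do rewrite ffunE permKV.
    rewrite -!mulrA; congr (_ * _); rewrite mulrCA [RHS]mulrCA.
    rewrite (mulrC (V g)); congr (_ * (_ * _)).
    by apply: eq_bigr => l _; rewrite ffunE.
  rewrite -big_distrr /= -mulrA; congr (_ * _).
  (* Summing over the orderings of one increasing tuple produces the second Vandermonde factor. *)
  have -> : \sum_(s : 'S_a) (-1) ^+ s * \prod_(l < a) p (g (s l)) ^+ l = V g.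
    rewrite /V -det_tr; apply: eq_bigr => s _; congr (_ * _).
    by apply: eq_bigr => i _; rewrite !mxE.
  have -> : V g = \det (Vandermonde a (\row_j p (g j))).
    by rewrite /V -det_tr; congr (\det _); apply/matrixP => i j; rewrite !mxE.
  rewrite det_Vandermonde -expr2 -prodrXl; apply: eq_bigr => u _.
  rewrite -prodrXl; apply: eq_bigr => v _.
  by rewrite !mxE -sqrrN opprB.
(* A repeated point gives V f two equal rows. *)
move=> f /injectivePn[u [v ne_uv eq_f]]; rewrite /G.
rewrite [V f](determinant_alternate ne_uv) ?mulr0 // => j.
by rewrite !mxE eq_f.
Qed.

End CauchyBinet.

(** * Hankel form of gamma and the sum over increasing tuples *)

Lemma gamma_hankel a b n :
  (gamma a (n + b) b)%:~R =
  (-1) ^+ 'C(a, 2) *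
  \det (\matrix_(i < a, j < a)
          (stirling2 (i + j + (n + b).+1) (a + b))%:R) :> rat.
Proof.
(* Column j has lower index a + b - d with d = a - 1 - j; this reversal makes the matrix of column
   operations antitriangular and accounts for the sign. *)
rewrite -(det_antitriangular a (descent_coef_diag rat (a + b))); last first.
  exact: descent_coef_gt.
rewrite mulrC -det_mulmx -(det_map_mx intr); congr (\det _).
apply/matrixP => i j; rewrite !mxE /= -pmulrn.
have -> : (j.+1 + b = a + b - (a.-1 - j))%N by have := ltn_ord j; lia.
rewrite (@stirling2_descent _ _ _ a); try by have := ltn_ord j; lia.
apply: eq_bigr => e _; rewrite !mxE mulrC.
by congr ((stirling2 _ _)%:R * _); lia.
Qed.

Lemma stirling2_coefA a b n l : (0 < a)%N ->
  (stirling2 (l + (n + b).+1) (a + b))%:R =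
  \sum_(x < (a + b).+1)
    coefA a b x * (x%:R : rat) ^ (n%:Z - a%:Z + 1) * x%:R ^+ l.
Proof.
move=> a_gt0; have fact_neq0 : ((a + b)`!)%:R != 0 :> rat.
  by rewrite pnatr_eq0 -lt0n fact_gt0.
apply: (mulfI fact_neq0); rewrite stirling2_explicit big_distrr.
apply: eq_bigr => x _ /=; rewrite /coefA.
(* At x = 0 both sides vanish, the right one because a > 0 gives 0^(a + b) = 0. Elsewhere x is
   invertible, so the exponent l + n + b + 1 splits even when n - a + 1 is negative. *)
have [-> | x_neq0] := eqVneq (x : nat) 0%N.
  have -> : 0 ^+ (a + b) = 0 :> rat by rewrite expr0n gtn_eqF ?ltn_addr.
  by rewrite addnS exprS; ring.
have x_unit : x%:R != 0 :> rat by rewrite pnatr_eq0.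
have -> : (x%:R : rat) ^+ (l + (n + b).+1) =
    x%:R ^+ (a + b) * x%:R ^ (n%:Z - a%:Z + 1) * x%:R ^+ l.
  by rewrite !exprnP -!expfzDr //; congr (_ ^ _); lia.
by field.
Qed.

Theorem theorem3 (a b n : nat) :
  let Sum : rat :=
    (-1) ^+ 'C(a, 2) *
    \sum_(i : {ffun 'I_a -> 'I_(a + b).+1} | increasing_indices i)
      ((\prod_(l < a) coefA a b (i l)) *
       (\prod_(u < a) \prod_(v < a | (u < v)%N) ((i u)%:R - (i v)%:R) ^+ 2) *
       (\prod_(l < a) ((i l)%:R : rat) ^ (n%:Z - a%:Z + 1))) in
  (beta n (a + b) b)%:~R = Sum /\ Sum = (gamma a (n + b) b)%:~R.
Proof.
move=> Sum; suff SumE : Sum = (gamma a (n + b) b)%:~R.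
  by rewrite beta_gamma SumE.
pose w (x : 'I_(a + b).+1) := coefA a b x * (x%:R : rat) ^ (n%:Z - a%:Z + 1).
have hankelE :
    \matrix_(i < a, j < a) (stirling2 (i + j + (n + b).+1) (a + b))%:R =
    \matrix_(i < a, j < a) \sum_x w x * x%:R ^+ (i + j).
  apply/matrixP => i j; rewrite !mxE stirling2_coefA //.
  exact: leq_ltn_trans (ltn_ord i).
rewrite gamma_hankel hankelE (det_moments _ w (fun x => x%:R)) /Sum.
congr (_ * _); rewrite big_mkcond [RHS]big_mkcond; apply: eq_bigr => i _ /=.
have -> : increasing_indices i = [forall l, (0 < i l)%N] && increasing i by [].
rewrite mulrAC -big_split /=.
(* The moment sum also ranges over tuples with an entry 0. They contribute nothing since
   [coefA a b 0] is 0; the existence of the position l ensures a > 0. *)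
case: forallP => //= not_pos; case: ifP => // _.
have /existsP[l] : [exists l, ~~ (0 < i l)%N].
  by rewrite -negb_forall; apply/forallP.
rewrite -eqn0Ngt => /eqP il0; rewrite (bigD1 l) //= /w /coefA il0 expr0n.
by rewrite gtn_eqF ?ltn_addr ?(leq_ltn_trans _ (ltn_ord l)) // !(mul0r, mulr0).
Qed.
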